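(* For any fixed positive integer $R$, for each $n$ there exists a sequence of reals $S=(\alpha_0,\ldots,\alpha_{M-1})$ such that every permutation $\sigma$ of $\{1,\ldots,n\}$ differs by at most $R$ transpositions from the order type of some consecutive $n$-word $(\alpha_i,\ldots,\alpha_{i+n-1})$ (indices mod $M$) of $S$, and $$\frac{n!}{n^{2R}}\prec M\prec\frac{n!\log n}{n^{2R}}.$$
   Context: Two sequences $(a_1,\ldots,a_k),(b_1,\ldots,b_k)\in\mathbb{R}^k$ have the same order type if $a_i<a_j$ iff $b_i<b_j$ for all $1\le i,j\le k$; the order type of a sequence of distinct reals is identified with the corresponding permutation of $\{1,\ldots,n\}$. The distance between permutations is the minimum number of transpositions needed to transform one into the other. $f\prec g$ means there is $c>0$ with $f(n)\le c\,g(n)$ for all sufficiently large $n$. *)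

(* Defs.v *)
From mathcomp Require Import all_boot all_fingroup.
From Stdlib Require Import Reals.
Set Implicit Arguments. Unset Strict Implicit. Unset Printing Implicit Defensive.

(* pi is the order type of the word w : 'I_n -> R (entries must then be
   pairwise distinct, since pi is injective). *)
Definition order_type (n : nat) (w : 'I_n -> R) (pi : 'S_n) : Prop :=
  forall i j : 'I_n, Rlt (w i) (w j) <-> (pi i < pi j)%N.

Definition within_transp (n : nat) (k : nat) (s t : 'S_n) : Prop :=
  exists ts : seq ('I_n * 'I_n),
    (size ts <= k)%N /\
    t = (s * \prod_(p <- ts) tperm p.1 p.2)%g.

Definition cyc_word (S : seq R) (n i : nat) : 'I_n -> R :=
  fun k => nth 0%R S ((i + k) %% size S).
Arguments cyc_word S n i k : clear implicits.

Definition covers (r n : nat) (S : seq R) : Prop :=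
  forall sigma : 'S_n, exists i : nat, (i < size S)%N /\
    exists pi : 'S_n, order_type (cyc_word S n i) pi /\ within_transp r pi sigma.

(* Main.v *)
(* Lower bound: a permutation within r transpositions of a window is determined by the
   window's position and r pairs of indices, so n! <= M * n^(2r).
   Upper bound: writing the word of a permutation t twice in a row exhibits all n of its
   cyclic rotations as windows, at a cost of 2n letters. Two distinct rotations disagree
   everywhere, hence lie at distance greater than 2r when n is large, so the balls around
   the rotations are disjoint; thus t takes care of at least n * c * n^(2r) permutations.
   A greedy choice of about (2r+1) ln n * n! / (c n^(2r+1)) words leaves at most
   n! / n^(2r+1) permutations uncovered, and these are added one by one. *)
Require Import Defs.
From mathcomp Require Import all_boot all_fingroup.
From mathcomp Require Import ssralg zmodp zify.
From Stdlib Require Import Reals.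
From Stdlib Require Import Lra IndefiniteDescription.
From Coquelicot Require Import Rcomplements.
(* Reals rebinds [^] in nat_scope. *)
Import ssrnat.
Set Implicit Arguments. Unset Strict Implicit. Unset Printing Implicit Defensive.

(** * Rotations, order types and the lower bound *)

(** Translation in the cyclic group on ['I_n.+1]. Products act from left to right, so [rotp i * t]
    reads the word of [t] cyclically from position [i]. *)
Definition rotp n (i : 'I_n.+1) : 'S_n.+1 := perm (@GRing.addrI _ i).

Lemma rotpE n (i z : 'I_n.+1) : rotp i z = GRing.add i z.
Proof. by rewrite permE. Qed.

Definition prod_transp n (ts : seq ('I_n * 'I_n)) : 'S_n :=
  (\prod_(p <- ts) tperm p.1 p.2)%g.

(** Padding with [tperm ord0 ord0], the identity, makes the length exactly [r], so the swaps range
    over a finite type that can be counted. *)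
Lemma within_transp_tuple n r (s t : 'S_n.+1) :
  within_transp r s t ->
  exists ts : r.-tuple ('I_n.+1 * 'I_n.+1), t = (s * prod_transp ts)%g.
Proof.
case=> ts [le_ts ->].
have size_ts : size (ts ++ nseq (r - size ts) (ord0, ord0)) == r.
  by rewrite size_cat size_nseq subnKC.
exists (Tuple size_ts); rewrite /prod_transp /= big_cat /=.
rewrite [X in (_ * (_ * X))%g]big1_seq ?mulg1 // => p /andP[_].
by rewrite mem_nseq => /andP[_ /eqP->]; rewrite tperm1.
Qed.

(** Each value is a rank, so comparisons alone determine a permutation; this makes order types
    unique. *)
Lemma card_below_perm n (s : 'S_n) (i : 'I_n) :
  #|[set j | (s j < s i)%N]| = s i.
Proof.
have -> : [set j | (s j < s i)%N] = s @^-1: [set k : 'I_n | (k < s i)%N].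
  by apply/setP=> j; rewrite !inE.
rewrite card_preimset; last exact: perm_inj.
rewrite -sum1dep_card (big_ord_narrow (ltnW (ltn_ord (s i)))) /=.
by rewrite sum1_card card_ord.
Qed.

Lemma order_type_uniq n (w : 'I_n -> R) (s t : 'S_n) :
  order_type w s -> order_type w t -> s = t.
Proof.
move=> ws wt; apply/permP=> i; apply/val_inj.
rewrite /= -(card_below_perm s i) -(card_below_perm t i).
congr #|pred_of_set _|; apply/setP=> j; rewrite !inE.
by apply/idP/idP=> [/ws/wt|/wt/ws].
Qed.

(** Choosing a window and an [r]-tuple of swaps for each permutation is injective: the window fixes
    its order type, and the swaps then fix the permutation. *)
Lemma covers_card r n (S : seq R) :
  covers r n.+1 S -> (n.+1`! <= size S * n.+1 ^ (2 * r))%N.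
Proof.
move=> covS.
pose ok (s : 'S_n.+1) (u : 'I_(size S) * r.-tuple ('I_n.+1 * 'I_n.+1)) :=
  exists2 p : 'S_n.+1, order_type (cyc_word S n.+1 u.1) p
                     & s = (p * prod_transp u.2)%g.
have /fin_all_exists[f okf] s : exists u, ok s u.
  have [i [lt_i [p [ot_p /within_transp_tuple[ts def_s]]]]] := covS s.
  by exists (Ordinal lt_i, ts), p.
have inj_f : injective f.
  move=> s t eq_f; have [p ot_p ->] := okf s; have [p' ot_p' ->] := okf t.
  by move: ot_p; rewrite eq_f => /order_type_uniq/(_ ot_p') ->.
have := leq_card f inj_f.
by rewrite card_Sn card_prod card_tuple card_prod !card_ord mulnn expnM.
Qed.

(** * From lists of permutations to sequences of reals *)

Definition near_rot r n (t s : 'S_n.+1) : bool :=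
  [exists i, [exists ts : r.-tuple ('I_n.+1 * 'I_n.+1),
    s == (rotp i * t * prod_transp ts)%g]].

Arguments near_rot r {n} t s.

Lemma near_rot_refl r n (s : 'S_n.+1) : near_rot r s s.
Proof.
apply/existsP; exists GRing.zero; apply/existsP; exists (nseq_tuple r (ord0, ord0)).
rewrite /prod_transp big1_seq => [|p /andP[_]]; last first.
  by rewrite mem_nseq => /andP[_ /eqP->]; rewrite tperm1.
by apply/eqP/permP=> x; rewrite mulg1 permM rotpE GRing.add0r.
Qed.

Lemma doubled_words_cover r n (L : seq 'S_n.+1) :
  (forall s : 'S_n.+1, has (near_rot r ^~ s) L) ->
  exists S : seq R, size S = (n.+1.*2 * size L)%N /\ covers r n.+1 S.
Proof.
move=> covL; pose m := n.+1.*2.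
(* Block [k %/ m] selects the permutation. As [n.+1] divides [m], [k %% n.+1] depends only on the
   place in the block, and each word appears twice. *)
pose letter k := INR (nth 1%g L (k %/ m) (inord (k %% n.+1))).
exists (mkseq letter (m * size L)); rewrite size_mkseq; split=> // s.
have /(has_nthP 1%g)[j lt_j /existsP[i /existsP[ts /eqP->]]] := covL s.
set t := nth _ _ _ in ts *.
have m_gt0 : (0 < m)%N by rewrite double_gt0.
have lt_block (k : nat) : (k < m)%N -> (j * m + k < m * size L)%N.
  move=> lt_k; apply: (@leq_trans (j.+1 * m)); first by rewrite mulSn addnC ltn_add2r.
  by rewrite mulnC leq_mul2l lt_j orbT.
have lt_i : (i < m)%N by rewrite (leq_trans (ltn_ord i)) // /m -addnn leq_addr.
exists (j * m + i)%N; rewrite size_mkseq; split; first exact: lt_block.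
exists (rotp i * t)%g; split; last by exists ts; rewrite size_tuple.
have wordE k : cyc_word (mkseq letter (m * size L)) n.+1 (j * m + i) k
             = INR ((rotp i * t)%g k).
  (* Both [i] and [k] are at most [n], so the window stays inside its block and never wraps
     around. *)
  have lt_ik : (i + k < m)%N.
    by rewrite /m -addnn -addSn leq_add // ltnW.
  rewrite /cyc_word size_mkseq -addnA modn_small ?lt_block //.
  rewrite nth_mkseq ?lt_block // /letter divnMDl // divn_small // addn0.
  rewrite permM rotpE; congr (INR (t _)); apply: val_inj.
  rewrite /= inordK ?ltn_pmod // /m -muln2 mulnA mulnAC modnMDl //.
move=> a b; rewrite !wordE; split=> [/INR_lt/ltP|/ltP/lt_INR] //.
Qed.

(** * Greedy covering *)

(* Double counting: some [a] covers at least the fraction [m / #|A|] of what is left. *)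
Lemma greedy_cover (A B : finType) (cov : A -> B -> bool) (m : nat) :
  (0 < #|A|)%N -> (forall b, (m <= #|[set a | cov a b]|)%N) ->
  forall K, exists2 L : seq A, size L = K &
    (#|[set b | ~~ has (cov^~ b) L]| * #|A| ^ K <= #|B| * (#|A| - m) ^ K)%N.
Proof.
move=> A_gt0 degB; elim=> [|K [L szL leL]].
  by exists nil => //; rewrite !expn0 !muln1 max_card.
set U := [set b | _] in leL.
have [a lea] : exists a, (m * #|U| <= #|[set b in U | cov a b]| * #|A|)%N.
  apply/existsP; rewrite -[X in is_true X]negbK negb_exists.
  apply/negP=> /forallP small.
  have double_count : (m * #|U| <= \sum_a #|[set b in U | cov a b]|)%N.
    rewrite mulnC -sum_nat_const.
    under [X in (_ <= X)%N]eq_bigr => a _ do rewrite -sum1dep_card big_mkcondr /=.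
    rewrite exchange_big /=; apply: leq_sum => b _.
    by rewrite -big_mkcond sum1dep_card.
  have [a0 _] := card_gt0P A_gt0.
  have : (\sum_a (#|[set b in U | cov a b]| * #|A|) < \sum_(a : A) m * #|U|)%N.
    rewrite [X in (X < _)%N](bigD1 a0) //= [X in (_ < X)%N](bigD1 a0) //= -addSn.
    apply: leq_add; first by rewrite ltnNge small.
    by apply: leq_sum => a _; rewrite ltnW // ltnNge small.
  by rewrite -big_distrl /= sum_nat_const mulnC ltn_pmul2l // ltnNge double_count.
exists (a :: L); first by rewrite /= szL.
have -> : [set b | ~~ has (cov^~ b) (a :: L)] = U :\: [set b in U | cov a b].
  by apply/setP=> b; rewrite !inE /= negb_or; case: (has _ _); rewrite ?andbF.
have step : (#|U :\: [set b in U | cov a b]| * #|A| <= #|U| * (#|A| - m))%N.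
  rewrite cardsD (setIidPr _); last by apply/subsetP=> b; rewrite inE => /andP[].
  by rewrite mulnBl mulnBr leq_sub2l // mulnC.
rewrite expnS mulnA (leq_trans (leq_mul step (leqnn _))) //.
by rewrite mulnAC expnSr mulnA leq_mul2r leL orbT.
Qed.

(** * Counting the permutations that have a rotation near a given one *)

Lemma prod_tperm_fix (T : finType) (I : eqType) (a b : I -> T) (s : seq I) z :
  {in s, forall l, z != a l /\ z != b l} ->
  (\prod_(l <- s) tperm (a l) (b l))%g z = z.
Proof.
move=> nz; rewrite big_seq; elim/big_ind: _ => [|p p' pz p'z|l /nz[za zb]].
- by rewrite perm1.
- by rewrite permM pz p'z.
- by rewrite tpermD // eq_sym.
Qed.

(** The factors have disjoint supports: those before [l] fix [a l], those after it fix [b l]. *)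
Lemma prod_tperm_swap (T : finType) (I : eqType) (a b : I -> T) (s : seq I) l :
  injective a -> injective b -> (forall k k', a k != b k') ->
  uniq s -> l \in s -> (\prod_(k <- s) tperm (a k) (b k))%g (a l) = b l.
Proof.
move=> inja injb ab; elim: s => //= k s IHs /andP[k_s uniq_s].
rewrite inE big_cons permM; have [-> _|lk /= l_s] := eqVneq l k.
  rewrite tpermL; apply: prod_tperm_fix => k' k'_s; split; first by rewrite eq_sym.
  by apply: contraNneq k_s => /injb ->.
rewrite tpermD ?IHs //; last by rewrite eq_sym.
by rewrite (inj_eq inja) eq_sym.
Qed.

Section DisjointSwaps.
Variables (r n q : nat).
Hypothesis small_q : (2 * (2 * r * q) <= n)%N.

(** The first [2 * r * q] points form [2 * r] blocks of length [q]. Swap [l] joins a chosen point of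
    block [l] to one of block [r + l], so the swaps are disjoint and the choices recoverable. *)
Definition swap_src (l : 'I_r) (a : 'I_q) : 'I_n.+1 := inord (l * q + a).
Definition swap_dst (l : 'I_r) (a : 'I_q) : 'I_n.+1 := inord ((r + l) * q + a).

Definition swaps (fg : {ffun 'I_r -> 'I_q} * {ffun 'I_r -> 'I_q}) : 'S_n.+1 :=
  (\prod_(l <- enum 'I_r) tperm (swap_src l (fg.1 l)) (swap_dst l (fg.2 l)))%g.

Let lt_src (l : 'I_r) (a : 'I_q) : (l * q + a < r * q)%N.
Proof.
by apply: (@leq_trans (l.+1 * q)); rewrite ?leq_mul2r ?ltn_ord ?orbT // mulSn addnC ltn_add2r.
Qed.

Let val_src l a : swap_src l a = (l * q + a)%N :> nat.
Proof.
by rewrite inordK // ltnS; move: (lt_src l a) small_q; rewrite -mulnA; lia.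
Qed.

Let val_dst l a : swap_dst l a = (r * q + (l * q + a))%N :> nat.
Proof.
rewrite inordK mulnDl -addnA // ltnS; move: (lt_src l a) small_q.
by rewrite -mulnA; lia.
Qed.

Let block_inj (l l' : 'I_r) (a a' : 'I_q) :
  (l * q + a)%N = (l' * q + a')%N -> l = l' /\ a = a'.
Proof.
have q_gt0 : (0 < q)%N by case: (q) a => [[]|].
move=> eq_la; split; apply: val_inj => /=.
  by have := congr1 (divn^~ q) eq_la; rewrite /= !divnMDl // !divn_small // !addn0.
by have := congr1 (modn^~ q) eq_la; rewrite /= !modnMDl !modn_small.
Qed.

Let src_inj l l' a a' : swap_src l a = swap_src l' a' -> l = l' /\ a = a'.
Proof. by move/(congr1 val); rewrite /= !val_src => /block_inj. Qed.

Let dst_inj l l' a a' : swap_dst l a = swap_dst l' a' -> l = l' /\ a = a'.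
Proof. by move/(congr1 val); rewrite /= !val_dst => /addnI/block_inj. Qed.

Let src_dst l l' a a' : swap_src l a != swap_dst l' a'.
Proof.
apply/eqP=> /(congr1 val); rewrite /= val_src val_dst => eq_sd.
by move: (lt_src l a); rewrite eq_sd ltnNge leq_addr.
Qed.

Lemma swaps_fix fg (z : 'I_n.+1) : (2 * r * q <= z)%N -> swaps fg z = z.
Proof.
move=> le_z; apply: prod_tperm_fix => l _.
by split; apply: contraTneq le_z => ->; rewrite ?val_src ?val_dst -ltnNge;
   have := lt_src l (fg.1 l); have := lt_src l (fg.2 l); rewrite -mulnA; lia.
Qed.

Lemma swaps_src fg l : swaps fg (swap_src l (fg.1 l)) = swap_dst l (fg.2 l).
Proof.
apply: (prod_tperm_swap (a := fun l => swap_src l (fg.1 l))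
                        (b := fun l => swap_dst l (fg.2 l))).
- by move=> k k' /src_inj[].
- by move=> k k' /dst_inj[].
- by move=> k k'.
- exact: enum_uniq.
- by rewrite mem_enum.
Qed.

(** A point of the first [r] blocks moves only if it was chosen, which recovers [fg.1]; the images
    recover [fg.2]. *)
Lemma swaps_inj : injective swaps.
Proof.
move=> fg fg' eq_s.
have eq_f l : fg.1 l = fg'.1 l.
  apply/eqP; apply: contraT => neq_f.
  have := swaps_src fg l; rewrite eq_s prod_tperm_fix => [/eqP|k _].
    by rewrite (negbTE (src_dst _ _ _ _)).
  split=> //; apply: contra neq_f => /eqP/src_inj[<- ->] //.
have eq_g l : fg.2 l = fg'.2 l.
  by have := swaps_src fg l; rewrite eq_s eq_f swaps_src => /dst_inj[].
case: fg fg' eq_f eq_g {eq_s} => [f g] [f' g'] /= eq_f eq_g.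
by congr pair; apply/ffunP.
Qed.

(* [swaps] only moves points below [2rq], that is, less than half of them, so some [z]
   escapes both permutations, and there the rotations [i] and [i'] must agree. *)
Lemma rot_swaps_inj (s : 'S_n.+1) :
  injective (fun u : 'I_n.+1 * _ => (rotp u.1 * s * (swaps u.2)^-1)%g).
Proof.
move=> [i fg] [i' fg'] /= eq_t.
pose W := [set z : 'I_n.+1 | (z < 2 * r * q)%N].
have cardW : (#|W| <= 2 * r * q)%N.
  have le_n : (2 * r * q <= n.+1)%N by lia.
  by rewrite -sum1dep_card (big_ord_narrow le_n) sum1_card card_ord.
have [z] : exists z, z \notin (rotp i * s)%g @^-1: W :|: (rotp i' * s)%g @^-1: W.
  apply/existsP; rewrite -[X in is_true X]negbK negb_exists.
  apply/negP=> /forallP inW.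
  have : (n.+1 <= #|(rotp i * s)%g @^-1: W :|: (rotp i' * s)%g @^-1: W|)%N.
    rewrite -[X in (X <= _)%N]card_ord; apply: subset_leq_card.
    by apply/subsetP=> z _; rewrite -[_ \in _]negbK inW.
  rewrite cardsU !card_preimset; try exact: perm_inj.
  move=> le_n; have {le_n} := leq_trans le_n (leq_subr _ _).
  by move: #|W| cardW => w le_w; lia.
rewrite !inE negb_or -!leqNgt => /andP[fix1 fix2].
have /eqP := congr1 (fun p : 'S_n.+1 => p z) eq_t; rewrite !(permM _ _^-1%g).
rewrite -{1}(swaps_fix fg fix1) -{1}(swaps_fix fg' fix2) !permK !permM.
rewrite (inj_eq perm_inj) !rotpE => /eqP/GRing.addIr eq_i.
by move: eq_t; rewrite eq_i => /mulgI/invg_inj/swaps_inj ->.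
Qed.

(** The greedy choice needs many [t] for each fixed [s]. They are found backwards, by rotating [s]
    and undoing swaps; the opposite rotation and the swaps lead back to [s]. *)
Lemma near_rot_degree (s : 'S_n.+1) :
  (n.+1 * q ^ (2 * r) <= #|[set t | near_rot r t s]|)%N.
Proof.
have <- : #|{: 'I_n.+1 * ({ffun 'I_r -> 'I_q} * {ffun 'I_r -> 'I_q})}|
        = (n.+1 * q ^ (2 * r))%N.
  by rewrite !card_prod !card_ffun !card_ord -expnD addnn mul2n.
rewrite -(card_imset _ (@rot_swaps_inj s)); apply: subset_leq_card.
apply/subsetP=> _ /imsetP[[i fg] _ ->]; rewrite inE.
apply/existsP; exists (GRing.opp i).
pose ts := [seq (swap_src l (fg.1 l), swap_dst l (fg.2 l)) | l <- enum 'I_r].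
have size_ts : size ts == r by rewrite size_map size_enum_ord.
apply/existsP; exists (Tuple size_ts); apply/eqP.
have -> : prod_transp (Tuple size_ts) = swaps fg by rewrite /prod_transp big_map.
rewrite /= !mulgA mulgKV; apply/permP=> z.
by rewrite !permM !rotpE GRing.addrA GRing.subrr GRing.add0r.
Qed.

End DisjointSwaps.

(** * Real estimates and the choice of parameters *)

Lemma INR_expn m k : INR (m ^ k)%N = (INR m ^ k)%R.
Proof. by elim: k => //= k IHk; rewrite expnS mult_INR IHk. Qed.

(** This is [1 - y <= exp (- y)] at [y = d / N], raised to the power [K]. *)
Lemma geometric_decay (u N d K : nat) : (0 < N)%N -> (d <= N)%N ->
  (u * N ^ K <= N * (N - d) ^ K)%N ->
  (INR u <= INR N * exp (- (INR d / INR N * INR K)))%R.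
Proof.
move=> /ltP/lt_0_INR N_gt0 le_d /leP/le_INR.
rewrite !mult_INR !INR_expn minus_INR; last exact/leP.
have {le_d} : (INR d <= INR N)%R by apply/le_INR/leP.
move: (INR N) (INR d) (INR u) N_gt0 => {}N x k N_gt0 le_x leU.
have pow_gt0 : (0 < N ^ K)%R by apply: pow_lt.
have base_ge0 : (0 <= 1 - x / N)%R.
  have : (x / N <= 1)%R; last by lra.
  by apply/Rle_div_l; lra.
apply: (@Rle_trans _ (N * (1 - x / N) ^ K)).
  apply: (Rmult_le_reg_r (N ^ K)) => //; apply: Rle_trans leU _.
  rewrite Rmult_assoc -Rpow_mult_distr; right; congr (_ * _ ^ _)%R.
  by field; lra.
apply: Rmult_le_compat_l; first by lra.
have -> : exp (- (x / N * INR K)) = (exp (- (x / N)) ^ K)%R.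
  by rewrite -Rpower_pow ?/Rpower ?ln_exp; [congr exp; ring | exact: exp_pos].
apply: pow_incr; split=> //.
by have := exp_ineq1_le (- (x / N)); lra.
Qed.

(** The [K] greedy choices are followed by all permutations left uncovered, each costing [2 * n.+1]
    letters. *)
Lemma short_cover r n q K : (4 * r * q <= n)%N ->
  exists S : seq R, covers r n.+1 S /\
    (INR (size S) <= 2 * INR n.+1 * (INR K + INR n.+1`! *
      exp (- (INR (n.+1 * q ^ (2 * r)) / INR n.+1`! * INR K))))%R.
Proof.
set d := (n.+1 * _)%N => le_q.
have {}le_q : (2 * (2 * r * q) <= n)%N by rewrite !mulnA.
have deg := near_rot_degree le_q.
have cardS : #|{: 'S_n.+1}| = n.+1`! by rewrite card_Sn.
have le_d : (d <= n.+1`!)%N.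
  by rewrite -cardS; apply: leq_trans (deg 1%g) (max_card _).
have [|L szL leU] := greedy_cover _ deg K; first by rewrite cardS fact_gt0.
set U := [set b | _] in leU; rewrite -/d cardS in leU.
have [s|S [szS covS]] := @doubled_words_cover r n (L ++ enum U).
  rewrite has_cat; case: (boolP (has _ L)) => //= noL.
  by apply/hasP; exists s; rewrite ?near_rot_refl // mem_enum inE.
exists S; split=> //.
rewrite szS size_cat szL -cardE -mul2n mult_INR mult_INR plus_INR.
rewrite -/U (_ : INR 2 = 2%R); last by rewrite /=; ring.
apply: Rmult_le_compat_l; first by have := pos_INR n.+1; lra.
apply: Rplus_le_compat_l; apply: geometric_decay => //.
exact: fact_gt0.
Qed.

Lemma efficient_cover r n : (0 < r)%N -> (4 * r <= n)%N ->
  exists S : seq R, covers r n.+1 S /\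
    (INR (size S) <= (4 * INR (2 * r).+1 * INR (8 * r) ^ (2 * r) + 2) *
      (INR n.+1`! * ln (INR n.+1) / INR n.+1 ^ (2 * r)))%R.
Proof.
move=> r_gt0 le_n; pose q := (n %/ (4 * r))%N.
have q_gt0 : (0 < q)%N by rewrite divn_gt0 ?muln_gt0.
have le_q : (4 * r * q <= n)%N by rewrite mulnC leq_divM.
have le_8rq : (n.+1 <= 8 * r * q)%N.
  have : (n < q.+1 * (4 * r))%N by apply: ltn_ceil; rewrite muln_gt0.
  by move: q_gt0; clearbody q; nia.
have N_gt0 : (0 < INR n.+1`!)%R by apply/lt_0_INR/ltP; rewrite fact_gt0.
have le_dN : (INR (n.+1 * q ^ (2 * r)) <= INR n.+1`!)%R.
  apply/le_INR/leP; rewrite -card_Sn.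
  have le_q' : (2 * (2 * r * q) <= n)%N by rewrite !mulnA.
  exact: leq_trans (near_rot_degree le_q' 1%g) (max_card _).
have x_ge3 : (3 <= INR n.+1)%R.
  have -> : 3%R = INR 3 by rewrite /=; ring.
  by apply/le_INR/leP; lia.
have ln_ge1 : (1 <= ln (INR n.+1))%R.
  rewrite -(ln_exp 1); have := exp_le_3 => e_le3.
  by apply: ln_le; [exact: exp_pos | lra].
have Q_gt0 : (0 < INR (q ^ (2 * r)))%R.
  by apply/lt_0_INR/ltP; rewrite expn_gt0 q_gt0.
have P_le : (INR n.+1 ^ (2 * r) <= INR (8 * r) ^ (2 * r) * INR (q ^ (2 * r)))%R.
  rewrite -!INR_expn -mult_INR; apply/le_INR/leP.
  by rewrite multE -expnMn leq_exp2r ?muln_gt0.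
have a_ge1 : (1 <= INR (2 * r).+1)%R by apply: (le_INR 1); lia.
have exp_ln : exp (- (INR (2 * r).+1 * ln (INR n.+1)))
            = (/ (INR n.+1 * INR n.+1 ^ (2 * r)))%R.
  rewrite exp_Ropp -/(Rpower _ _) Rpower_pow //; lra.
have P_gt0 : (0 < INR n.+1 ^ (2 * r))%R by apply: pow_lt; lra.
have short K := short_cover K le_q.
move: le_dN short; rewrite mult_INR.
move: (INR (8 * r) ^ _)%R P_le => C P_le.
move: (INR n.+1 ^ _)%R P_gt0 P_le exp_ln => P P_gt0 P_le exp_ln.
move: (INR (q ^ _)) Q_gt0 P_le => Q Q_gt0 P_le.
move: (INR n.+1`!) N_gt0 => N N_gt0.
move: (INR n.+1) x_ge3 ln_ge1 exp_ln => x x_ge3 L_ge1 exp_ln.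
move: (INR (2 * r).+1) a_ge1 exp_ln => a a_ge1 exp_ln le_dN short.
have [d_gt0 NQ_gt0] : (0 < x * Q /\ 0 < N / Q)%R.
  by split; [apply: Rmult_lt_0_compat; lra | apply: Rdiv_lt_0_compat].
(* Chosen so that [t] greedy words bring the exponential factor down to [/ (x * P)], where [P]
   stands for [x ^ (2 * r)] and [a] for [2 * r + 1]. *)
pose t := (a * ln x * (N / (x * Q)))%R.
have t_ge1 : (1 <= t)%R.
  have ? : (1 <= N / (x * Q))%R by apply/Rle_div_r => //; lra.
  have ? : (1 <= a * ln x)%R by nra.
  by rewrite /t; nra.
(* Rounding up at most doubles [t], because [t >= 1]. *)
have [K [ltK leK]] : exists K : nat, (t <= INR K <= 2 * t)%R.
  have [gt_t le_t] := archimed t.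
  have up_ge0 : (0 <= up t)%Z by apply: le_IZR; lra.
  have [K up_t] := IZN _ up_ge0; exists K.
  by rewrite INR_IZR_INZ -up_t; lra.
have [S [covS leS]] := short K; exists S; split=> //.
apply: Rle_trans leS _.
have le_exp : (exp (- (x * Q / N * INR K)) <= / (x * P))%R.
  rewrite -exp_ln; apply: Rnot_lt_le => /exp_lt_inv; apply/Rle_not_lt/Ropp_le_contravar.
  have -> : (a * ln x = x * Q / N * t)%R by rewrite /t; field; lra.
  by apply: Rmult_le_compat_l => //; apply/Rlt_le/Rdiv_lt_0_compat.
apply: (@Rle_trans _ (2 * x * (2 * t + N * / (x * P)))).
  apply: Rmult_le_compat_l; first by lra.
  apply: Rplus_le_compat => //; apply: Rmult_le_compat_l => //; lra.
(* The first term counts the letters of the greedy words, the second those of the leftovers. *)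
have -> : (2 * x * (2 * t + N * / (x * P))
         = 4 * a * (N * ln x) * / Q + 2 * (N * / P))%R.
  by rewrite /t; field; lra.
have Q_le : (/ Q <= C * / P)%R.
  apply: (Rmult_le_reg_r (P * Q)); first exact: Rmult_lt_0_compat.
  have -> : (/ Q * (P * Q) = P)%R by field; lra.
  by have -> : (C * / P * (P * Q) = C * Q)%R by field; lra.
have ? : (0 < / P)%R by apply: Rinv_0_lt_compat.
have ? : (N <= N * ln x)%R by nra.
rewrite /Rdiv Rmult_plus_distr_r; apply: Rplus_le_compat; last by nra.
have -> : (4 * a * C * (N * ln x * / P) = 4 * a * (N * ln x) * (C * / P))%R by ring.
by apply: Rmult_le_compat_l => //; nra.
Qed.

Theorem theorem4 (r : nat) (hr : (0 < r)%N) :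
  exists Mf : nat -> nat,
    (forall n : nat, exists S : seq R, size S = Mf n /\ covers r n S) /\
    (exists c1 c2 : R, (0 < c1)%R /\ (0 < c2)%R /\
      exists N : nat, forall n : nat, (N <= n)%N ->
        (INR (n`!) / INR n ^ (2 * r) <= c1 * INR (Mf n))%R /\
        (INR (Mf n) <= c2 * (INR (n`!) * ln (INR n) / INR n ^ (2 * r)))%R).
Proof.
set c2 := (4 * INR (2 * r).+1 * INR (8 * r) ^ (2 * r) + 2)%R.
(* The size bound is demanded only beyond [4 * r]; before that, any covering sequence will do. *)
pose good n (S : seq R) := covers r n S /\
  ((4 * r < n)%N -> INR (size S) <=
     c2 * (INR (n`!) * ln (INR n) / INR n ^ (2 * r)))%R.
have /functional_choice[Sf goodSf] n : exists S, good n S.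
  case: n => [|n].
    (* Even for [n = 0] a start index below the size is required, so the sequence must be
       nonempty. *)
    exists [:: 0%R]; split=> // s; exists 0%N; split=> //.
    by exists s; split=> [[]|] //; exists nil; rewrite big_nil mulg1.
  case: (leqP (4 * r) n) => [le_n|lt_n].
    by have [S [covS leS]] := efficient_cover hr le_n; exists S.
  (* With [K = 0] the greedy stage is empty and every permutation is a leftover. *)
  have [|S [covS _]] := @short_cover r n 0 0; first by rewrite muln0.
  by exists S; split=> //; rewrite ltnS leqNgt lt_n.
exists (fun n => size (Sf n)); split=> [n|].
  by exists (Sf n); have [] := goodSf n.
exists 1%R, c2; split; first by lra.
split.
  have := pow_le _ (2 * r) (pos_INR (8 * r)); have := pos_INR (2 * r).+1.
  by rewrite /c2; nra.
exists (4 * r).+1 => -[//|n] lt_n; have [covS /(_ lt_n) leS] := goodSf n.+1.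
split=> //; rewrite Rmult_1_l; apply/Rle_div_l.
  by apply/pow_lt/lt_0_INR/ltP.
by rewrite -INR_expn -mult_INR; apply/le_INR/leP/covers_card.
Qed.
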